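(* Let $0<q<1$, let $\alpha>0$ be a real number, and let $f(x)=\sum_{n\ge 0}A_nx^n$ be a power series with $(A_n)$ a bounded sequence. Let $u,v>0$ be such that the series $\sum_{n\ge0}A_n x^n$ converges at $x=u/v$. Then $$N_q\left(x^{\alpha-1}f(x)\right)(u;v)=\frac{(1-q)^{\alpha-1}}{v^{\alpha}}\,u^{\alpha-1}\sum_{n\ge 0}A_n\frac{u^n}{v^n}(1-q)^n\,\Gamma_q(\alpha+n).$$
   Context: For $0<q<1$: $(a;q)_n=\prod_{k=0}^{n-1}(1-aq^k)$, $(a;q)_\infty=\prod_{k\ge0}(1-aq^k)$, and $E_q(t)=\sum_{n\ge0}(-1)^n\frac{q^{n(n-1)/2}}{(q;q)_n}t^n=(t;q)_\infty$. The $q$-gamma function is $\Gamma_q(x)=\frac{(q;q)_\infty}{(q^x;q)_\infty}(1-q)^{1-x}$. The Jackson integral is $\int_0^a f(x)\,d_qx=(1-q)a\sum_{k\ge0}f(aq^k)q^k$ (when the sum converges absolutely). The $q$-Natural transform of the first type is $$N_q(f)(u;v)=\frac{1}{(1-q)u}\int_0^{u/v}f(t)\,E_q\!\left(q\tfrac{v}{u}t\right)d_qt=\frac{(q;q)_\infty}{v}\sum_{k\ge0}\frac{q^kf\left(\frac uv q^k\right)}{(q;q)_k},$$ and $N_q(g(x))(u;v)$ denotes the transform of the function $x\mapsto g(x)$. *)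

(* Defs.v *)
From Stdlib Require Import Reals.
From Coquelicot Require Import Coquelicot.
Open Scope R_scope.

(* Real powers of positive numbers are
   [Rpower], natural powers are [^]; [Lim_seq] and [Series] are total, so
   convergence is a separate predicate wherever it is not automatic. *)

Fixpoint qpoch (a q : R) (n : nat) : R :=
  match n with
  | O => 1
  | S m => qpoch a q m * (1 - a * q ^ m)
  end.

(* The limit exists for every real [a] as soon as 0 < q < 1. *)
Definition qpoch_inf (a q : R) : R := real (Lim_seq (qpoch a q)).

(* The series converges for every real [t] as soon as 0 < q < 1. *)
Definition Eqexp (q t : R) : R :=
  Series (fun n => (-1) ^ n * (q ^ (n * (n - 1) / 2)%nat / qpoch q q n) * t ^ n).

Definition Gammaq (q x : R) : R :=
  qpoch_inf q q / qpoch_inf (Rpower q x) q * Rpower (1 - q) (1 - x).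

Definition ex_jackson (q : R) (f : R -> R) (a : R) : Prop :=
  ex_series (fun k => Rabs (f (a * q ^ k) * q ^ k)).

(* The value is meaningful only under [ex_jackson q f a]. *)
Definition jackson (q : R) (f : R -> R) (a : R) : R :=
  (1 - q) * a * Series (fun k => f (a * q ^ k) * q ^ k).

Definition qNatural_integrand (q : R) (f : R -> R) (u v t : R) : R :=
  f t * Eqexp q (q * (v / u) * t).

Definition ex_qNatural (q : R) (f : R -> R) (u v : R) : Prop :=
  ex_jackson q (qNatural_integrand q f u v) (u / v).

Definition qNatural (q : R) (f : R -> R) (u v : R) : R :=
  1 / ((1 - q) * u) * jackson q (qNatural_integrand q f u v) (u / v).

(* Main.v *)
Require Import Defs.
From Stdlib Require Import Reals Lra Lia.
From Coquelicot Require Import Coquelicot.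
Open Scope R_scope.

(** The q-exponential satisfies [E(t) = (1 - t) E(q t)], and therefore the power series [H]
    whose coefficients are the values [E(q^(k+1))] of the kernel at the Jackson nodes satisfies
    [H(q z) = (1 - z) H(z)].  Iterating both equations and using continuity at 0 gives
    [(t;q)_inf = E(t)] and [(z;q)_inf = H(0) / H(z)] with [H(0) = (q;q)_inf], so that
    [Gamma_q(s) = H(q^s) (1 - q)^(1 - s)].  Both sides of the theorem are then the two ways of
    summing the double series with terms [A_n r^n q^(k n) q^(alpha k) E(q^(k+1))], [r = u/v].
    The double series need not converge absolutely, but the partial sums over [n] converge
    uniformly in [k], which is enough to exchange the summations. *)

(** * Powers of [q] and finite q-Pochhammer products *)

Lemma pow_le_1 (q : R) (n : nat) : 0 < q < 1 -> 0 < q ^ n <= 1.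
Proof.
  intros [h0 h1]; split; [now apply pow_lt |].
  rewrite <- (pow1 n); apply pow_incr; lra.
Qed.

Lemma pow_lt_1 (q : R) (n : nat) : 0 < q < 1 -> 0 < q ^ S n < 1.
Proof.
  intros hq; assert (h := pow_le_1 q n hq); simpl; nra.
Qed.

(** Lets [n] tend to infinity in the iterated functional equations, where only the value at 0
    survives. *)
Lemma is_lim_seq_pow_comp (f : R -> R) (q t : R) : 0 < q < 1 ->
  continuity_pt f 0 -> is_lim_seq (fun n => f (q ^ n * t)) (f 0).
Proof.
  intros hq hf.
  apply (is_lim_seq_continuous f (fun n => q ^ n * t)); [exact hf |].
  replace (Finite 0) with (Rbar_mult 0 t) by (simpl; f_equal; ring).
  apply is_lim_seq_scal_r, is_lim_seq_geom.
  rewrite Rabs_pos_eq; lra.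
Qed.

Lemma qpoch_gt_0 (a q : R) (n : nat) : 0 < q < 1 -> a < 1 -> 0 < qpoch a q n.
Proof.
  intros hq ha; induction n as [|n IH]; simpl; [lra |].
  apply Rmult_lt_0_compat; [exact IH |].
  assert (h := pow_le_1 q n hq). nra.
Qed.

(** * The q-exponential and its infinite product *)

Definition Ecoef (q : R) (n : nat) : R :=
  (-1) ^ n * (q ^ (n * (n - 1) / 2)%nat / qpoch q q n).

Lemma Eqexp_PSeries (q t : R) : Eqexp q t = PSeries (Ecoef q) t.
Proof. reflexivity. Qed.

Lemma Ecoef_S (q : R) (n : nat) : 0 < q < 1 ->
  Ecoef q (S n) = - (q ^ n / (1 - q ^ S n)) * Ecoef q n.
Proof.
  intros hq; unfold Ecoef.
  replace (S n * (S n - 1) / 2)%nat with (n + n * (n - 1) / 2)%nat.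
  - rewrite pow_add; simpl.
    assert (h := qpoch_gt_0 q q n hq (proj2 hq)).
    assert (h' := pow_lt_1 q n hq). simpl in h'.
    field; split; lra.
  (* Adding [n * 2] to the dividend adds exactly [n] to the quotient, so the parity of [n * (n - 1)]
     never matters. *)
  - replace (S n * (S n - 1))%nat with (n * (n - 1) + n * 2)%nat by (destruct n; simpl; nia).
    rewrite Nat.div_add; lia.
Qed.

Lemma Ecoef_neq_0 (q : R) (n : nat) : 0 < q < 1 -> Ecoef q n <> 0.
Proof.
  intros hq; unfold Ecoef.
  assert (h := qpoch_gt_0 q q n hq (proj2 hq)).
  apply Rmult_integral_contrapositive_currified; [apply pow_nonzero; lra |].
  apply Rmult_integral_contrapositive_currified; [apply pow_nonzero; lra |].
  apply Rinv_neq_0_compat; lra.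
Qed.

Lemma CV_radius_Ecoef (q : R) : 0 < q < 1 -> CV_radius (Ecoef q) = p_infty.
Proof.
  intros hq; apply CV_radius_infinite_DAlembert; [intros n; now apply Ecoef_neq_0 |].
  apply is_lim_seq_ext with (fun n => q ^ n / (1 - q ^ S n)).
  - intros n. rewrite Ecoef_S by exact hq.
    assert (h := pow_lt_1 q n hq).
    assert (hn : 0 < q ^ n) by now apply pow_lt.
    replace (_ / Ecoef q n) with (- (q ^ n / (1 - q ^ S n)))
      by (field; split; [lra | now apply Ecoef_neq_0]).
    rewrite Rabs_Ropp, Rabs_pos_eq; [reflexivity |].
    apply Rlt_le, Rdiv_lt_0_compat; lra.
  - assert (hg : is_lim_seq (fun n => q ^ n) 0)
      by (apply is_lim_seq_geom; rewrite Rabs_pos_eq; lra).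
    replace 0 with (0 / (1 - 0)) by field.
    apply is_lim_seq_div'; [exact hg | | lra].
    apply is_lim_seq_minus'; [apply is_lim_seq_const |].
    now apply (is_lim_seq_incr_1 (fun n => q ^ n)).
Qed.

Lemma Eqexp_0 (q : R) : Eqexp q 0 = 1.
Proof.
  rewrite Eqexp_PSeries, PSeries_0; unfold Ecoef; simpl; field.
Qed.

Lemma continuity_pt_Eqexp (q t : R) : 0 < q < 1 -> continuity_pt (Eqexp q) t.
Proof.
  intros hq; apply (PSeries_continuity (Ecoef q)).
  now rewrite CV_radius_Ecoef.
Qed.

Lemma is_series_PSeries (a : nat -> R) (x : R) :
  Rbar_lt (Rabs x) (CV_radius a) -> is_series (fun n => a n * x ^ n) (PSeries a x).
Proof.
  intros h; apply Series_correct, ex_pseries_R, CV_radius_inside, h.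
Qed.

(** The coefficients satisfy c_(n+1) (1 - q^(n+1)) = - q^n c_n. Comparing termwise, this says E(t) -
    E(q t) = - t E(q t). *)
Lemma Eqexp_rec (q t : R) : 0 < q < 1 -> Eqexp q t = (1 - t) * Eqexp q (q * t).
Proof.
  intros hq; rewrite !Eqexp_PSeries.
  assert (hs : forall x, is_series (fun n => Ecoef q n * x ^ n) (PSeries (Ecoef q) x)).
  { intros x; apply is_series_PSeries; now rewrite CV_radius_Ecoef. }
  assert (h1 := is_series_minus _ _ _ _ (hs t) (hs (q * t))).
  assert (h2 : is_series (fun n => plus (Ecoef q n * t ^ n) (opp (Ecoef q n * (q * t) ^ n)))
                 (- t * PSeries (Ecoef q) (q * t))).
  (* The constant terms of the two series cancel, so the difference may be summed from index 1 on,
     where the recursion applies. *)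
  { apply is_series_decr_1.
    replace (plus _ _) with (scal (- t) (PSeries (Ecoef q) (q * t)))
      by (unfold scal, plus, opp; simpl; unfold mult; simpl; ring).
    eapply is_series_ext; [| exact (is_series_scal_l (- t) _ _ (hs (q * t)))].
    intros n; rewrite Ecoef_S by exact hq.
    assert (h := pow_lt_1 q n hq). simpl in h.
    unfold scal, plus, opp; simpl; unfold mult; simpl.
    rewrite !Rpow_mult_distr; field; lra. }
  assert (h := eq_trans (eq_sym (is_series_unique _ _ h2)) (is_series_unique _ _ h1)).
  unfold plus, opp in h; simpl in h. lra.
Qed.

Lemma Eqexp_iter (q t : R) (n : nat) : 0 < q < 1 ->
  Eqexp q t = qpoch t q n * Eqexp q (q ^ n * t).
Proof.
  intros hq; induction n as [|n IH]; simpl; [rewrite !Rmult_1_l; reflexivity |].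
  rewrite IH, (Eqexp_rec q (q ^ n * t) hq), <- Rmult_assoc, (Rmult_comm _ t), Rmult_assoc.
  rewrite !Rmult_assoc; do 2 f_equal; f_equal; ring.
Qed.

(** In E(t) = (t;q)_n E(q^n t) the finite product is positive, and the other factor tends to E(0) =
    1. *)
Lemma Eqexp_gt_0 (q t : R) : 0 < q < 1 -> t < 1 -> 0 < Eqexp q t.
Proof.
  intros hq ht.
  assert (hl := is_lim_seq_pow_comp (Eqexp q) q t hq (continuity_pt_Eqexp q 0 hq)).
  rewrite Eqexp_0 in hl; apply is_lim_seq_spec in hl.
  (* Distance less than 1 from the limit 1 already forces E(q^N t) > 0. *)
  destruct (hl (mkposreal 1 Rlt_0_1)) as [N hN].
  specialize (hN N (le_n N)); simpl in hN; apply Rabs_lt_between in hN.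
  rewrite (Eqexp_iter q t N hq).
  apply Rmult_lt_0_compat; [now apply qpoch_gt_0 | lra].
Qed.

Lemma qpoch_inf_Eqexp (q t : R) : 0 < q < 1 -> t < 1 -> qpoch_inf t q = Eqexp q t.
Proof.
  intros hq ht; unfold qpoch_inf.
  rewrite (is_lim_seq_unique _ (Eqexp q t)); [reflexivity |].
  apply is_lim_seq_ext with (fun n => Eqexp q t / Eqexp q (q ^ n * t)).
  - intros n; rewrite (Eqexp_iter q t n hq) at 1; field.
    (* E(q^n t) is nonzero because it is a factor of the positive number E(t). *)
    assert (h := Eqexp_gt_0 q t hq ht); rewrite (Eqexp_iter q t n hq) in h.
    intros h0; rewrite h0 in h; lra.
  - replace (Eqexp q t) with (Eqexp q t / Eqexp q 0) at 1 by (rewrite Eqexp_0; field).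
    apply is_lim_seq_div'; [apply is_lim_seq_const | | rewrite Eqexp_0; lra].
    apply is_lim_seq_pow_comp; [exact hq | now apply continuity_pt_Eqexp].
Qed.

(** * The generating function of the kernel values *)

Definition Eqexp_pow (q : R) (k : nat) : R := Eqexp q (q ^ S k).

Lemma Eqexp_pow_gt_0 (q : R) (k : nat) : 0 < q < 1 -> 0 < Eqexp_pow q k.
Proof. intros hq; apply Eqexp_gt_0; [exact hq | now apply pow_lt_1]. Qed.

Lemma Eqexp_pow_rec (q : R) (k : nat) : 0 < q < 1 ->
  Eqexp_pow q k = (1 - q ^ S k) * Eqexp_pow q (S k).
Proof. intros hq; exact (Eqexp_rec q (q ^ S k) hq). Qed.

(** Consecutive coefficients have ratio 1 / (1 - q^(n+1)), which tends to 1. This is why [z] stays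
    below 1 from here on. *)
Lemma CV_radius_Eqexp_pow (q : R) : 0 < q < 1 -> CV_radius (Eqexp_pow q) = 1.
Proof.
  intros hq.
  rewrite (CV_radius_finite_DAlembert _ 1); [now rewrite Rinv_1 | | lra |].
  - intros n; assert (h := Eqexp_pow_gt_0 q n hq); lra.
  - apply is_lim_seq_ext with (fun n => 1 / (1 - q ^ S n)).
    + intros n; rewrite (Eqexp_pow_rec q n hq).
      assert (h := Eqexp_pow_gt_0 q (S n) hq); assert (h' := pow_lt_1 q n hq).
      replace (_ / ((1 - q ^ S n) * _)) with (1 / (1 - q ^ S n)) by (field; lra).
      symmetry; apply Rabs_pos_eq, Rlt_le, Rdiv_lt_0_compat; lra.
    + replace (Finite 1) with (Finite (1 / (1 - 0))) by (f_equal; field).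
      apply is_lim_seq_div'; [apply is_lim_seq_const | | lra].
      apply is_lim_seq_minus'; [apply is_lim_seq_const |].
      apply (is_lim_seq_incr_1 (fun n => q ^ n)), is_lim_seq_geom.
      rewrite Rabs_pos_eq; lra.
Qed.

(** The function [H] of the introduction. On [0, 1) it is (q;q)_inf / (z;q)_inf, an instance of the
    q-binomial theorem. *)
Definition EqGen (q : R) : R -> R := PSeries (Eqexp_pow q).

Lemma is_series_EqGen (q z : R) : 0 < q < 1 -> 0 <= z < 1 ->
  is_series (fun k => Eqexp_pow q k * z ^ k) (EqGen q z).
Proof.
  intros hq hz; apply is_series_PSeries.
  rewrite CV_radius_Eqexp_pow by exact hq; simpl; rewrite Rabs_pos_eq; lra.
Qed.

Lemma EqGen_0 (q : R) : EqGen q 0 = Eqexp q q.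
Proof.
  unfold EqGen; rewrite PSeries_0; unfold Eqexp_pow; f_equal; ring.
Qed.

(** With e_k = E(q^(k+1)), the recursion (1 - q^(n+1)) e_(n+1) = e_n turns the termwise difference
    H(z) - H(q z) into z H(z). *)
Lemma EqGen_rec (q z : R) : 0 < q < 1 -> 0 <= z < 1 ->
  EqGen q (q * z) = (1 - z) * EqGen q z.
Proof.
  intros hq hz.
  assert (hqz : 0 <= q * z < 1) by nra.
  assert (h1 := is_series_minus _ _ _ _ (is_series_EqGen q z hq hz)
                  (is_series_EqGen q (q * z) hq hqz)).
  assert (h2 : is_series (fun n => plus (Eqexp_pow q n * z ^ n)
                 (opp (Eqexp_pow q n * (q * z) ^ n))) (z * EqGen q z)).
  { apply is_series_decr_1.
    replace (plus _ _) with (scal z (EqGen q z))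
      by (unfold scal, plus, opp; simpl; unfold mult; simpl; ring).
    eapply is_series_ext; [| exact (is_series_scal_l z _ _ (is_series_EqGen q z hq hz))].
    intros n; change (z * (Eqexp_pow q n * z ^ n)
                      = Eqexp_pow q (S n) * z ^ S n - Eqexp_pow q (S n) * (q * z) ^ S n).
    rewrite (Eqexp_pow_rec q n hq), Rpow_mult_distr; simpl; ring. }
  assert (h := eq_trans (eq_sym (is_series_unique _ _ h2)) (is_series_unique _ _ h1)).
  unfold plus, opp in h; simpl in h. lra.
Qed.

Lemma EqGen_iter (q z : R) (n : nat) : 0 < q < 1 -> 0 <= z < 1 ->
  EqGen q (q ^ n * z) = qpoch z q n * EqGen q z.
Proof.
  intros hq hz; induction n as [|n IH]; simpl; [rewrite !Rmult_1_l; reflexivity |].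
  rewrite Rmult_assoc, EqGen_rec, IH; [ring | exact hq |].
  assert (h := pow_le_1 q n hq). nra.
Qed.

Lemma EqGen_gt_0 (q z : R) : 0 < q < 1 -> 0 <= z < 1 -> 0 < EqGen q z.
Proof.
  intros hq hz; assert (h := is_series_EqGen q z hq hz).
  unfold EqGen, PSeries; rewrite Series_incr_1 by (now exists (EqGen q z)).
  apply Rplus_lt_le_0_compat; [simpl; rewrite Rmult_1_r; now apply Eqexp_pow_gt_0 |].
  (* The bound 0 is written as a series of zero multiples of the same terms, so that [Series_le]
     compares termwise. *)
  rewrite <- (Rmult_0_l (Series (fun k => Eqexp_pow q (S k) * z ^ S k))), <- Series_scal_l.
  apply Series_le.
  - intros n; rewrite Rmult_0_l; split; [lra |].
    apply Rmult_le_pos; [now apply Rlt_le, Eqexp_pow_gt_0 | now apply pow_le].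
  - apply (ex_series_incr_1 (fun k => Eqexp_pow q k * z ^ k)); now exists (EqGen q z).
Qed.

Lemma qpoch_inf_EqGen (q z : R) : 0 < q < 1 -> 0 <= z < 1 ->
  qpoch_inf z q = Eqexp q q / EqGen q z.
Proof.
  intros hq hz; unfold qpoch_inf.
  rewrite (is_lim_seq_unique _ (Eqexp q q / EqGen q z)); [reflexivity |].
  assert (hz' := EqGen_gt_0 q z hq hz).
  apply is_lim_seq_ext with (fun n => EqGen q (q ^ n * z) / EqGen q z).
  - intros n; rewrite EqGen_iter by assumption; field; lra.
  - rewrite <- EqGen_0.
    apply is_lim_seq_div'; [| apply is_lim_seq_const | lra].
    apply is_lim_seq_pow_comp; [exact hq |].
    apply PSeries_continuity; rewrite CV_radius_Eqexp_pow by exact hq.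
    simpl; rewrite Rabs_R0; lra.
Qed.

(** * The q-gamma function *)

Lemma Rpower_lt_1 (q s : R) : 0 < q < 1 -> 0 < s -> 0 < Rpower q s < 1.
Proof.
  intros hq hs; split; [apply exp_pos |].
  unfold Rpower; rewrite <- exp_0; apply exp_increasing.
  assert (ln q < 0) by (rewrite <- ln_1; apply ln_increasing; lra). nra.
Qed.

(** The numerator (q;q)_inf and the constant H(0) in (q^s;q)_inf = H(0) / H(q^s) both equal E(q),
    hence cancel. *)
Lemma Gammaq_EqGen (q s : R) : 0 < q < 1 -> 0 < s ->
  Gammaq q s = EqGen q (Rpower q s) * Rpower (1 - q) (1 - s).
Proof.
  intros hq hs; unfold Gammaq.
  assert (hz := Rpower_lt_1 q s hq hs).
  rewrite (qpoch_inf_EqGen q (Rpower q s)), qpoch_inf_Eqexp by (try exact hq; lra).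
  assert (h := EqGen_gt_0 q (Rpower q s) hq ltac:(lra)).
  assert (h' := Eqexp_gt_0 q q hq (proj2 hq)).
  field; lra.
Qed.

(** * Exchange of summations by uniform convergence *)

Lemma is_series_weighted_uniform (w F : nat -> R) (S : nat -> nat -> R)
    (T delta : nat -> R) (M : R) :
  (forall k, 0 <= w k) -> ex_series w -> (forall k, Rabs (F k) <= M) ->
  (forall N k, Rabs (S N k - F k) <= delta N) -> is_lim_seq delta 0 ->
  (forall N, is_series (fun k => w k * S N k) (T N)) ->
  ex_series (fun k => Rabs (w k * F k)) /\ is_lim_seq T (Series (fun k => w k * F k)).
Proof.
  intros hw0 hw hF hS hdelta hT.
  assert (hex : ex_series (fun k => Rabs (w k * F k))).
  { apply (ex_series_le (V := R_CompleteNormedModule) _ (fun k => M * w k)).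
    - intros k; change (Rabs (Rabs (w k * F k)) <= M * w k).
      rewrite Rabs_Rabsolu, Rabs_mult, (Rabs_pos_eq (w k)), Rmult_comm by apply hw0.
      apply Rmult_le_compat_r; [apply hw0 | apply hF].
    - exact (ex_series_scal_l M w hw). }
  split; [exact hex |].
  assert (hF' := Series_correct _ (ex_series_Rabs _ hex)).
  set (L := Series (fun k => w k * F k)) in *.
  apply is_lim_seq_ext with (fun N => (T N - L) + L); [intros; ring |].
  replace (Finite L) with (Finite (0 + L)) by (f_equal; ring).
  apply is_lim_seq_plus'; [| apply is_lim_seq_const].
  apply is_lim_seq_abs_0.
  (* [T N] and [L] are sums with the same nonnegative weights, so they differ by at most the uniform
     error [delta N] times the total weight. *)
  apply is_lim_seq_le_le with (fun _ => 0) (fun N => delta N * Series w);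
    [| apply is_lim_seq_const |].
  - intros N; split; [apply Rabs_pos |].
    assert (hb : forall k, Rabs (w k * S N k - w k * F k) <= delta N * w k).
    { intros k; rewrite <- Rmult_minus_distr_l, Rabs_mult, (Rabs_pos_eq (w k)), Rmult_comm
        by apply hw0.
      apply Rmult_le_compat_r; [apply hw0 | apply hS]. }
    assert (hexw : ex_series (fun k => delta N * w k)) by exact (ex_series_scal_l (delta N) w hw).
    assert (hexd : ex_series (fun k => Rabs (w k * S N k - w k * F k))).
    { apply (ex_series_le (V := R_CompleteNormedModule) _ (fun k => delta N * w k)); [| exact hexw].
      intros k; change (Rabs (Rabs (w k * S N k - w k * F k)) <= delta N * w k).
      rewrite Rabs_Rabsolu; apply hb. }
    replace (T N - L) with (Series (fun k => w k * S N k - w k * F k))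
      by (apply is_series_unique, (is_series_minus _ _ _ _ (hT N) hF')).
    eapply Rle_trans; [apply Series_Rabs, hexd |].
    rewrite <- Series_scal_l; apply Series_le; [| exact hexw].
    intros k; split; [apply Rabs_pos | apply hb].
  - replace (Finite 0) with (Rbar_mult 0 (Series w)) by (simpl; f_equal; ring).
    now apply is_lim_seq_scal_r.
Qed.

Lemma ex_series_bounded (a : nat -> R) : ex_series a -> exists C, forall n, Rabs (a n) <= C.
Proof.
  intros ha; destruct (filterlim_bounded a) as [C hC].
  - exists 0; exact (ex_series_lim_0 a ha).
  - exists C; exact hC.
Qed.

(* The node [k = 0] lies on the boundary of the disk of convergence, so it is handled by
   convergence of [sum a n] itself; all other nodes lie in the disk of radius [q]. *)
Lemma PSeries_pow_tail (a : nat -> R) (q : R) : 0 < q < 1 -> ex_series a ->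
  exists delta, is_lim_seq delta 0 /\
    forall N k, Rabs (sum_n (fun n => a n * (q ^ k) ^ n) N - PSeries a (q ^ k)) <= delta N.
Proof.
  intros hq ha; destruct (ex_series_bounded a ha) as [C hC].
  assert (hC0 : 0 <= C) by (eapply Rle_trans; [apply Rabs_pos | apply (hC 0%nat)]).
  (* The first summand is the error at [k = 0]. The second is the geometric tail of C q^n beyond
     [N], which dominates the error at every node in [0, q]. *)
  exists (fun N => Rabs (sum_n a N - Series a) + C * (q ^ S N * / (1 - q))); split.
  - replace (Finite 0) with (Finite (0 + C * (0 * / (1 - q)))) by (f_equal; ring).
    apply is_lim_seq_plus'.
    + apply (is_lim_seq_abs_0 (fun N => sum_n a N - Series a)).
      replace 0 with (Series a - Series a) by ring.
      apply is_lim_seq_minus'; [exact (Series_correct a ha) | apply is_lim_seq_const].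
    + apply (is_lim_seq_scal_l _ C (Finite _)), (is_lim_seq_scal_r _ _ (Finite 0)).
      apply (is_lim_seq_incr_1 (fun n => q ^ n)), is_lim_seq_geom; rewrite Rabs_pos_eq; lra.
  - intros N k; destruct k as [|k].
    + rewrite (sum_n_ext _ a) by (intros n; simpl; rewrite pow1; apply Rmult_1_r).
      replace (PSeries a (q ^ 0)) with (Series a)
        by (apply Series_ext; intros n; simpl; rewrite pow1; ring).
      assert (0 <= C * (q ^ S N * / (1 - q))); [| lra].
      apply Rmult_le_pos; [exact hC0 |].
      apply Rmult_le_pos; [apply pow_le; lra | apply Rlt_le, Rinv_0_lt_compat; lra].
    + assert (hx : 0 <= q ^ S k <= q).
      { assert (h := pow_le_1 q k hq). simpl; nra. }
      set (x := q ^ S k) in *.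
      assert (hb : forall n, Rabs (a n * x ^ n) <= C * q ^ n).
      { intros n; rewrite Rabs_mult, (Rabs_pos_eq (x ^ n)) by (apply pow_le; lra).
        apply Rmult_le_compat; [apply Rabs_pos | apply pow_le; lra | apply hC |].
        apply pow_incr; exact hx. }
      assert (hg : is_series (fun n => C * q ^ (S N + n)) (C * (q ^ S N * / (1 - q)))).
      { apply (is_series_scal_l C (fun n => q ^ (S N + n))).
        apply is_series_ext with (fun n => q ^ S N * q ^ n);
          [intros n; now rewrite pow_add |].
        apply (is_series_scal_l (q ^ S N) (fun n => q ^ n)), is_series_geom.
        rewrite Rabs_pos_eq; lra. }
      assert (hex : ex_series (fun n => a n * x ^ n)).
      { apply (ex_series_le (V := R_CompleteNormedModule) _ (fun n => C * q ^ n) hb).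
        apply (ex_series_scal_l C (fun n => q ^ n)), ex_series_geom; rewrite Rabs_pos_eq; lra. }
      (* [sum_n] up to [N] has [N + 1] terms, so the tail starts at [S N]. *)
      unfold PSeries; rewrite (Series_incr_n _ (S N)) by (lia || exact hex).
      rewrite sum_n_Reals; simpl pred.
      replace (_ - _) with (- Series (fun n => a (S N + n)%nat * x ^ (S N + n))) by ring.
      rewrite Rabs_Ropp.
      assert (hexa : ex_series (fun n => Rabs (a (S N + n)%nat * x ^ (S N + n)))).
      { apply (ex_series_le (V := R_CompleteNormedModule) _ (fun n => C * q ^ (S N + n)));
          [| eexists; exact hg].
        intros n; change (Rabs (Rabs (a (S N + n)%nat * x ^ (S N + n))) <= C * q ^ (S N + n)).
        rewrite Rabs_Rabsolu; apply hb. }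
      eapply Rle_trans; [apply Series_Rabs, hexa |].
      assert (h : Series (fun n => Rabs (a (S N + n)%nat * x ^ (S N + n)))
                  <= C * (q ^ S N * / (1 - q))).
      { rewrite <- (is_series_unique _ _ hg); apply Series_le; [| eexists; exact hg].
        intros n; split; [apply Rabs_pos | apply hb]. }
      assert (h' := Rabs_pos (sum_n a N - Series a)); lra.
Qed.

Lemma PSeries_pow_bounded (a : nat -> R) (q : R) : 0 < q < 1 -> ex_series a ->
  exists M, forall k, Rabs (PSeries a (q ^ k)) <= M.
Proof.
  intros hq ha; destruct (PSeries_pow_tail a q hq ha) as [delta [_ hd]].
  (* The partial sum for [N = 0] is the constant [a 0], and every value lies within [delta 0] of
     it. *)
  exists (Rabs (a 0%nat) + delta 0%nat); intros k.
  specialize (hd 0%nat k); rewrite sum_O, Rmult_1_r in hd.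
  rewrite Rabs_minus_sym in hd.
  assert (h := Rabs_triang_inv (PSeries a (q ^ k)) (a 0%nat)); lra.
Qed.

(** The factor q^(k n) is absorbed into z^k, giving H(z q^n) for each [n]; the finite sum over [n]
    then follows by linearity. *)
Lemma is_series_EqGen_pow (q z : R) (a : nat -> R) (N : nat) : 0 < q < 1 -> 0 <= z < 1 ->
  is_series (fun k => Eqexp_pow q k * z ^ k * sum_n (fun n => a n * (q ^ k) ^ n) N)
    (sum_n (fun n => a n * EqGen q (z * q ^ n)) N).
Proof.
  intros hq hz.
  assert (h : forall n, is_series (fun k => Eqexp_pow q k * z ^ k * (a n * (q ^ k) ^ n))
                (a n * EqGen q (z * q ^ n))).
  { intros n.
    assert (hzn : 0 <= z * q ^ n < 1).
    { assert (h := pow_le_1 q n hq). nra. }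
    eapply is_series_ext; [| exact (is_series_scal_l (a n) _ _ (is_series_EqGen q _ hq hzn))].
    intros k; change (a n * (Eqexp_pow q k * (z * q ^ n) ^ k) =
                      Eqexp_pow q k * z ^ k * (a n * (q ^ k) ^ n)).
    rewrite Rpow_mult_distr, <- !pow_mult, (Nat.mul_comm n k); ring. }
  induction N as [|N IH].
  - rewrite sum_O; eapply is_series_ext; [| exact (h 0%nat)].
    intros k; now rewrite sum_O.
  - rewrite sum_Sn; eapply is_series_ext; [| exact (is_series_plus _ _ _ _ IH (h (S N)))].
    intros k; rewrite sum_Sn; unfold plus; simpl; ring.
Qed.

Lemma is_series_EqGen_exchange (q z : R) (a : nat -> R) :
  0 < q < 1 -> 0 <= z < 1 -> ex_series a ->
  ex_series (fun k => Rabs (Eqexp_pow q k * z ^ k * PSeries a (q ^ k))) /\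
  is_series (fun n => a n * EqGen q (z * q ^ n))
    (Series (fun k => Eqexp_pow q k * z ^ k * PSeries a (q ^ k))).
Proof.
  intros hq hz ha.
  destruct (PSeries_pow_tail a q hq ha) as [delta [hd0 hd]].
  destruct (PSeries_pow_bounded a q hq ha) as [M hM].
  (* [is_series] is by definition convergence of the partial sums, which here play the role of
     [T]. *)
  apply (is_series_weighted_uniform (fun k => Eqexp_pow q k * z ^ k) (fun k => PSeries a (q ^ k))
           (fun N k => sum_n (fun n => a n * (q ^ k) ^ n) N) _ delta M); try assumption.
  - intros k; apply Rmult_le_pos; [now apply Rlt_le, Eqexp_pow_gt_0 | now apply pow_le].
  - eexists; exact (is_series_EqGen q z hq hz).
  - intros N; now apply is_series_EqGen_pow.
Qed.

(** * The transform as a sum over the Jackson nodes *)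

Theorem theorem1 (q : R) (hq0 : 0 < q) (hq1 : q < 1)
    (alpha : R) (halpha : 0 < alpha)
    (A : nat -> R) (hA : exists M : R, forall n : nat, Rabs (A n) <= M)
    (u v : R) (hu : 0 < u) (hv : 0 < v)
    (hconv : ex_series (fun n => A n * (u / v) ^ n)) :
  let g := fun x : R => Rpower x (alpha - 1) * PSeries A x in
  let b := fun n : nat =>
    A n * (u ^ n / v ^ n) * (1 - q) ^ n * Gammaq q (alpha + INR n) in
  ex_qNatural q g u v /\
  ex_series b /\
  qNatural q g u v =
    Rpower (1 - q) (alpha - 1) / Rpower v alpha * Rpower u (alpha - 1) * Series b.
Proof.
  intros g b.
  assert (hq : 0 < q < 1) by lra.
  assert (hr : 0 < u / v) by (apply Rdiv_lt_0_compat; assumption).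
  (* Absorbing [u / v] into the coefficients places the Jackson nodes at q^k, and [hconv] becomes
     convergence at the node 1. *)
  set (a := fun n => A n * (u / v) ^ n) in *.
  set (z := Rpower q alpha).
  assert (hz : 0 < z < 1) by now apply Rpower_lt_1.
  destruct (is_series_EqGen_exchange q z a hq ltac:(lra) hconv) as [hex hser].
  set (W := fun k => Eqexp_pow q k * z ^ k * PSeries a (q ^ k)) in *.
  assert (hterm : forall k, qNatural_integrand q g u v (u / v * q ^ k) * q ^ k
                    = Rpower (u / v) (alpha - 1) * W k).
  { intros k; unfold qNatural_integrand, g, W, Eqexp_pow.
    assert (hqk : 0 < q ^ k) by now apply pow_lt.
    replace (q * (v / u) * (u / v * q ^ k)) with (q ^ S k) by (simpl; field; lra).
    replace (PSeries A (u / v * q ^ k)) with (PSeries a (q ^ k))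
      by (apply Series_ext; intros n; unfold a; rewrite Rpow_mult_distr; ring).
    rewrite <- Rpower_mult_distr by assumption.
    (* The Jackson weight q^k raises the exponent [alpha - 1] to [alpha]. *)
    replace (z ^ k) with (Rpower (q ^ k) (alpha - 1) * q ^ k); [ring |].
    rewrite <- (Rpower_1 (q ^ k)) at 2 by exact hqk.
    rewrite <- Rpower_plus, <- !Rpower_pow by (unfold z; try apply exp_pos; lra).
    unfold z; rewrite !Rpower_mult; f_equal; ring. }
  (* Here q^(alpha + n) = z q^n, and the factor (1 - q)^n cancels the dependence on [n] of the power
     of 1 - q in the q-gamma value. *)
  assert (hb : forall n, Rpower (1 - q) (1 - alpha) * (a n * EqGen q (z * q ^ n)) = b n).
  { intros n; unfold b, a.
    assert (hn := pos_INR n).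
    rewrite Gammaq_EqGen by (try exact hq; lra).
    rewrite Rpower_plus, Rpower_pow by lra; fold z.
    replace (1 - (alpha + INR n)) with ((1 - alpha) + - INR n) by ring.
    rewrite Rpower_plus, Rpower_Ropp, Rpower_pow by lra.
    unfold Rdiv; rewrite Rpow_mult_distr, pow_inv.
    field; split; apply pow_nonzero; lra. }
  assert (hbs : is_series b (Rpower (1 - q) (1 - alpha) * Series W)).
  { eapply is_series_ext; [exact hb |].
    exact (is_series_scal_l (Rpower (1 - q) (1 - alpha)) _ _ hser). }
  split; [| split].
  - apply ex_series_ext with (fun k => Rabs (Rpower (u / v) (alpha - 1)) * Rabs (W k)).
    + intros k; now rewrite hterm, Rabs_mult.
    + exact (ex_series_scal_l (Rabs (Rpower (u / v) (alpha - 1))) _ hex).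
  - eexists; exact hbs.
  - rewrite (is_series_unique _ _ hbs).
    unfold qNatural, jackson; rewrite (Series_ext _ _ hterm), Series_scal_l.
    assert (h1 : Rpower (1 - q) (alpha - 1) * Rpower (1 - q) (1 - alpha) = 1).
    { rewrite <- Rpower_plus; replace (alpha - 1 + (1 - alpha)) with 0 by ring.
      apply Rpower_O; lra. }
    assert (h2 : Rpower u (alpha - 1) = Rpower (u / v) (alpha - 1) * Rpower v (alpha - 1)).
    { rewrite Rpower_mult_distr by assumption; f_equal; field; lra. }
    assert (h3 : Rpower v alpha = Rpower v (alpha - 1) * v).
    { rewrite <- (Rpower_1 v) at 3 by exact hv.
      rewrite <- Rpower_plus; f_equal; ring. }
    assert (h4 : 0 < Rpower v (alpha - 1)) by apply exp_pos.
    rewrite h2, h3.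
    (* The prefactors 1 / ((1 - q) u) and (1 - q) u / v of the transform and the Jackson integral
       multiply to 1 / v. *)
    transitivity (Rpower (u / v) (alpha - 1) * Series W / v); [field; lra |].
    transitivity ((Rpower (1 - q) (alpha - 1) * Rpower (1 - q) (1 - alpha))
                  * (Rpower (u / v) (alpha - 1) * Series W / v)); [rewrite h1; ring |].
    field; lra.
Qed.
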